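(* The class of B-extensions that are neither G- nor D-extensions is precisely the class of normal finite field extensions that are neither Galois nor purely inseparable field extensions. That is, for a finite field extension $L/K$: $L/K$ is a B-extension that is neither a G-extension nor a D-extension if and only if $L/K$ is normal and is neither Galois nor purely inseparable.
   Context: For a finite field extension $L/K$: $E(L/K)=\mathrm{End}_K(L)$; $L$ is viewed as a subfield of $E(L/K)$ via multiplication operators. $G(L/K)=\mathrm{Aut}_{K\text{-alg}}(L)\subseteq E(L/K)$. $\mathcal{D}(L/K)=\bigcup_{i\ge0}\mathcal{D}_i\subseteq E(L/K)$ is the algebra of $K$-linear differential operators on $L$, where $\mathcal{D}_0=L$ and $\mathcal{D}_i=\{\delta\in E(L/K)\mid\delta l-l\delta\in\mathcal{D}_{i-1}\text{ for all }l\in L\}$. $\mathcal{D}(L/K)\rtimes G(L/K)=\bigoplus_{g\in G(L/K)}\mathcal{D}(L/K)g$ and $L\rtimes G(L/K)=\bigoplus_{g\in G(L/K)}Lg$ are the subalgebras of $E(L/K)$ generated by $\mathcal{D}(L/K)$ and $G(L/K)$, respectively by $L$ and $G(L/K)$. A finite field extension $L/K$ is called a B-extension if $E(L/K)=\mathcal{D}(L/K)\rtimes G(L/K)$, a G-extension if $E(L/K)=L\rtimes G(L/K)$, and a D-extension if $E(L/K)=\mathcal{D}(L/K)$. *)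

(* Defs.v *)
From HB Require Import structures.
From mathcomp Require Import all_boot all_order all_algebra all_field.

Set Implicit Arguments.
Unset Strict Implicit.
Unset Printing Implicit Defensive.

Import GRing.Theory FalgLfun.
Local Open Scope ring_scope.

(* For L : fieldExtType K, the algebra E(L/K) is 'End(L). Its ring product
   (from FalgLfun) is composition in the reverse order, (f * g) u = g (f u),
   so compositions are written with \o below; subalgebras do not depend on
   the order. *)

(* The subfield L of E(L/K). *)
Definition mul_op (K : fieldType) (L : fieldExtType K) (f : 'End(L)) : Prop :=
  exists l : L, f = amull l.

(* The K-automorphisms of L: kAut 1 {:L} f says that f is multiplicative,
   fixes K = 1%VS pointwise, and maps L onto L. *)
Definition galois_op (K : fieldType) (L : fieldExtType K) (f : 'End(L)) :
  Prop := kAut 1%VS {:L} f.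

Fixpoint diff_op_of_order (K : fieldType) (L : fieldExtType K) (i : nat)
    (d : 'End(L)) : Prop :=
  if i is j.+1 then
    forall l : L,
      diff_op_of_order j ((d \o amull l)%VF - (amull l \o d)%VF)
  else mul_op d.

Definition diff_op (K : fieldType) (L : fieldExtType K) (d : 'End(L)) : Prop :=
  exists i : nat, diff_op_of_order i d.

(* The subalgebra generated by S and T is the intersection of the subalgebras
   containing both. An {aspace _} may have a unit other than \1, but this
   cannot happen here: S always contains \1 = amull 1. *)
Definition generated_subalgebra (K : fieldType) (L : fieldExtType K)
    (S T : 'End(L) -> Prop) (f : 'End(L)) : Prop :=
  forall A : {aspace 'End(L)},
    (forall s : 'End(L), S s -> s \in A) ->
    (forall t : 'End(L), T t -> t \in A) ->
    f \in A.

Definition B_extension (K : fieldType) (L : fieldExtType K) : Prop :=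
  forall f : 'End(L), generated_subalgebra (@diff_op K L) (@galois_op K L) f.

Definition G_extension (K : fieldType) (L : fieldExtType K) : Prop :=
  forall f : 'End(L), generated_subalgebra (@mul_op K L) (@galois_op K L) f.

Definition D_extension (K : fieldType) (L : fieldExtType K) : Prop :=
  forall f : 'End(L), diff_op f.

(* normalField and galois are only available when L is already known to be a
   splitting field over K, hence normal; this is the textbook definition, for
   an arbitrary finite extension. *)
Definition normal_extension (K : fieldType) (L : fieldExtType K) : Prop :=
  forall p : {poly K}, irreducible_poly p ->
    (exists x : L, root (map_poly (in_alg L) p) x) ->
    exists rs : seq L, map_poly (in_alg L) p %= \prod_(z <- rs) ('X - z%:P).

Definition galois_extension (K : fieldType) (L : fieldExtType K) : Prop :=
  normal_extension L /\ separable 1%VS {:L}.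

Definition purely_inseparable_extension (K : fieldType) (L : fieldExtType K) :
  Prop := purely_inseparable 1%VS {:L}.

(* Main.v *)
Require Import Defs.
From HB Require Import structures.
From mathcomp Require Import all_boot all_order all_algebra all_field.
From mathcomp Require Import ring.
From Stdlib Require Import Classical.

(* A subalgebra of E(L/K) containing L is determined by its centraliser, which
   lies in L: by Jacobson density it is all of E(L/K) as soon as the centraliser
   is K. The elements of L commuting with all differential operators are those
   separable over K, and those commuting with G(L/K) are its fixed points. Hence
   L/K is a D-extension iff every separable element of L lies in K, a
   G-extension iff G(L/K) fixes only K, and a B-extension iff every separable
   element fixed by G(L/K) lies in K; these are the purely inseparable, Galois
   and normal extensions respectively. *)

Set Implicit Arguments.
Unset Strict Implicit.
Unset Printing Implicit Defensive.

Import GRing.Theory FalgLfun.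
Local Open Scope ring_scope.

(** * Commutators with elements of L, and differential operators *)

Section DifferentialOperators.

Variables (K : fieldType) (L : fieldExtType K).
Implicit Types (d e f : 'End(L)) (l m x u : L).

Definition diff_comm l d : 'End(L) := (d \o amull l)%VF - (amull l \o d)%VF.

Lemma amullE l u : amull l u = l * u.
Proof. by rewrite lfunE. Qed.

Lemma diff_commE l d u : diff_comm l d u = d (l * u) - l * d u.
Proof. by rewrite /diff_comm !lfunE /= !lfunE /= !lfunE /= lfunE. Qed.

Lemma diff_commC l m d :
  diff_comm l (diff_comm m d) = diff_comm m (diff_comm l d).
Proof.
by apply/lfunP=> u; rewrite !diff_commE (mulrCA m l u); ring.
Qed.

Lemma diff_comm_sum (I : Type) (r : seq I) (c : I -> K) (b : I -> L) d :
  diff_comm (\sum_(i <- r) c i *: b i) d =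
  \sum_(i <- r) c i *: diff_comm (b i) d.
Proof.
apply/lfunP=> u; rewrite diff_commE sum_lfunE !mulr_suml linear_sum -sumrB.
apply: eq_bigr => i _.
by rewrite scale_lfunE diff_commE -!scalerAl linearZ /= scalerBr.
Qed.

Lemma diff_op_orderS i d : diff_op_of_order i d -> diff_op_of_order i.+1 d.
Proof.
elim: i d => [|i IHi] d /= Dd l; last exact/IHi/Dd.
case: Dd => m ->; exists 0; apply/lfunP=> u; rewrite diff_commE !amullE.
by rewrite mulrCA subrr mul0r.
Qed.

Lemma diff_op_order_leq i j d :
  (i <= j)%N -> diff_op_of_order i d -> diff_op_of_order j d.
Proof.
by move/subnK<-; elim: (j - i)%N => //= k IHk /IHk; apply: diff_op_orderS.
Qed.

Lemma diff_op_order_lin i (a : K) d e :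
  diff_op_of_order i d -> diff_op_of_order i e ->
  diff_op_of_order i (a *: d + e).
Proof.
elim: i d e => [|i IHi] d e /=.
  by move=> [l ->] [m ->]; exists (a *: l + m); rewrite linearP.
move=> Dd De l; rewrite -/(diff_comm l _).
suffices ->: diff_comm l (a *: d + e) = a *: diff_comm l d + diff_comm l e.
  by apply: IHi; [apply: Dd | apply: De].
apply/lfunP=> u; rewrite [RHS]add_lfunE [X in _ = X + _]scale_lfunE.
rewrite !diff_commE !add_lfunE !scale_lfunE scalerBr mulrDr opprD addrACA.
by rewrite scalerAr.
Qed.

Lemma diff_op_order0 i : diff_op_of_order i (0 : 'End(L)).
Proof. by apply: (@diff_op_order_leq 0) => //; exists 0; rewrite linear0. Qed.

Lemma diff_op_order_sum i n (c : 'I_n -> K) (d : 'I_n -> 'End(L)) :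
  (forall j, diff_op_of_order i (d j)) ->
  diff_op_of_order i (\sum_j c j *: d j).
Proof.
move=> Dd; elim/big_rec: _ => [|j e _ De]; first exact: diff_op_order0.
exact: diff_op_order_lin.
Qed.

Lemma diff_op0 : diff_op (0 : 'End(L)).
Proof. by exists 0%N; apply: diff_op_order0. Qed.

Lemma diff_op_diff_comm l d : diff_op d -> diff_op (diff_comm l d).
Proof. by case=> i /diff_op_orderS/(_ l); exists i. Qed.

Lemma diff_op_iter_diff_comm l n d :
  diff_op d -> diff_op (iter n (diff_comm l) d).
Proof. by move=> Dd; elim: n => //= n; apply: diff_op_diff_comm. Qed.

Lemma iter_diff_commC l m n d :
  diff_comm m (iter n (diff_comm l) d) = iter n (diff_comm l) (diff_comm m d).
Proof. by elim: n => //= n <-; apply: diff_commC. Qed.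

Lemma iter_diff_comm0 l n : iter n (diff_comm l) 0 = 0.
Proof.
elim: n => //= n ->; apply/lfunP=> u.
by rewrite diff_commE !zero_lfunE mulr0 subrr.
Qed.

(** The commutator is K-linear in [l], so the largest of the orders found on a finite basis bounds
    the order for every [l]. *)
Lemma diff_op_basis d :
  (forall i : 'I_(\dim {:L}), diff_op (diff_comm (vbasis {:L})`_i d)) ->
  diff_op d.
Proof.
move=> /fin_all_exists[o Do]; exists (\max_i o i).+1 => l.
rewrite -/(diff_comm l d) (coord_vbasis (memvf l)) diff_comm_sum.
apply: diff_op_order_sum => i; apply: diff_op_order_leq (Do i).
exact: leq_bigmax.
Qed.

(* The maps [diff_comm l] commute with one another, so if they are all
   nilpotent on [d], they have a common kernel in the quotient by the
   differential operators unless [d] is one already. *)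
Lemma diff_op_nilpotent d :
  (forall l, exists n, iter n (diff_comm l) d = 0) -> diff_op d.
Proof.
move=> nil_d; pose b := vbasis {:L}.
(* [s] lists the basis vectors whose commutator with [d] is not yet known to be differential; the
   induction removes them one at a time. *)
suffices: forall s : seq L, forall d,
    (forall l, exists n, iter n (diff_comm l) d = 0) ->
    (forall l, l \in b -> l \notin s -> diff_op (diff_comm l d)) -> diff_op d.
  by move=> H; apply: (H b) => // l ->.
elim=> [|m s IHs] {nil_d}d nil_d Dd.
  by apply: diff_op_basis => i; apply: Dd; rewrite ?mem_nth ?size_tuple.
have [n dn0] := nil_d m.
suffices: forall k, diff_op (iter (n - k) (diff_comm m) d).
  by move/(_ n); rewrite subnn.
elim=> [|k IHk]; first by rewrite subn0 dn0; apply: diff_op0.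
(* Subtraction is truncated: when [n <= k], both iterates are [d] itself. *)
have [le_nk | lt_kn] := leqP n k.
  by move: IHk; have /eqP-> := le_nk; have /eqP-> := leqW le_nk.
apply: IHs => [l | l bl s'l].
  have [q dq0] := nil_d l; exists q.
  suffices ->: forall e, iter q (diff_comm l) (iter (n - k.+1) (diff_comm m) e)
     = iter (n - k.+1) (diff_comm m) (iter q (diff_comm l) e).
    by rewrite dq0 iter_diff_comm0.
  by move=> e; elim: (q) => //= q' ->; rewrite iter_diff_commC.
have [-> | neq_lm] := eqVneq l m.
  by move: IHk; rewrite -subSS subSn.
rewrite iter_diff_commC; apply/diff_op_iter_diff_comm/Dd => //.
by rewrite inE negb_or neq_lm.
Qed.

(** A Taylor formula in [x] that stops at first order, because the second commutator with [x]
    vanishes. *)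
Lemma diff_op_horner d x (p : {poly K}) u (q := map_poly (in_alg L) p) :
    diff_comm x (diff_comm x d) = 0 ->
  d (q.[x] * u) = q.[x] * d u + q^`().[x] * diff_comm x d u.
Proof.
move=> d2; have dx v : diff_comm x d (x * v) = x * diff_comm x d v.
  by apply/eqP; rewrite -subr_eq0 -diff_commE d2 zero_lfunE.
have {}d2 v : d (x * v) = x * d v + diff_comm x d v.
  by rewrite diff_commE addrC subrK.
rewrite {}/q; elim/poly_ind: p u => [|p c IHp] u.
  by rewrite !rmorph0 deriv0 !horner0 !mul0r linear0 addr0.
rewrite rmorphD rmorphM /= map_polyX map_polyC /= derivD derivC addr0 derivM.
rewrite derivX mulr1 !hornerE mulrDl linearD /= -mulrA IHp d2 dx.
rewrite -[c%:A * u]scalerAl mul1r linearZ /= -(mul1r (d u)) scalerAl mul1r.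
ring.
Qed.

(** By induction on the order, the second commutator of [d] with [x] vanishes. The Taylor formula
    for the minimal polynomial p of [x] then makes p'(x) times the first commutator zero, and p'(x)
    is nonzero by separability. *)
Lemma diff_op_separable d x u :
  diff_op d -> separable_element 1 x -> d (x * u) = x * d u.
Proof.
case=> i Dd sep_x; apply/eqP; rewrite -subr_eq0 -diff_commE.
suffices ->: diff_comm x d = 0 by rewrite zero_lfunE.
elim: i d Dd => [|i IHi] d /= Dd; apply/lfunP=> v; rewrite zero_lfunE.
  by case: Dd => l ->; rewrite diff_commE !amullE mulrCA subrr.
have /polyOver1P[p Dp] := minPolyOver 1 x.
have:= diff_op_horner p v (IHi _ (Dd x)).
rewrite -Dp minPolyxx !mul0r linear0 add0r => /esym/eqP.
rewrite mulf_eq0 => /orP[|/eqP//] p'x0.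
by have := separable_root_der 1%AS x; rewrite sep_x /root p'x0.
Qed.

(** [diff_comm l] is the difference of two commuting operators on E(L/K), pre- and postcomposition
    with [amull l], and Frobenius is additive on commuting elements. *)
Lemma iter_diff_comm_pchar l d n : [pchar L].-nat n ->
  iter n (diff_comm l) d = diff_comm (l ^+ n) d.
Proof.
move=> pchar_n; pose a : 'End('End(L)) := amull (amull l).
pose b : 'End('End(L)) := amulr (amull l).
have ->: iter n (diff_comm l) d = ((a - b) ^+ n) d.
  elim: n {pchar_n} => [|n IHn]; first by rewrite expr0 id_lfunE.
  by rewrite exprSr lfun_mulE iterS IHn add_lfunE opp_lfunE !lfunE.
have ab : GRing.comm a b.
  by apply/lfunP=> e; rewrite [LHS]lfun_mulE [RHS]lfun_mulE !lfunE /= mulrA.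
have ->: (a - b) ^+ n = a ^+ n - b ^+ n.
  (* In characteristic zero only [n = 1] occurs. *)
  have [|n_gt1] := leqP n 1; first by case: n pchar_n => [|[]].
  pose p := pdiv n; have pcharLp: p \in [pchar L].
    by rewrite (pnatPpi pchar_n) ?pi_pdiv.
  have /p_natP[e ->]: p.-nat n by rewrite -(eq_pnat _ (pcharf_eq pcharLp)).
  have pcharEp: p \in [pchar 'End('End(L))].
    by rewrite pchar_lalg -(pchar_lalg L).
  elim: e => // e IHe; rewrite !expnSr !exprM IHe -(pFrobenius_autE pcharEp).
  by rewrite pFrobenius_autB_comm //; apply/commrX/commr_sym/commrX/commr_sym.
have amullX (A : falgType K) (x : A) k : amull x ^+ k = amull (x ^+ k).
  elim: k => [|k IHk]; first by rewrite !expr0 amull1.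
  by rewrite exprSr exprS IHk amullM.
by rewrite add_lfunE opp_lfunE /a /b amullX -rmorphXn !lfunE /= amullX.
Qed.

End DifferentialOperators.

(** * Centralisers in E(L/K) and the double centraliser argument *)

Section Centralisers.

Variables (K : fieldType) (L : fieldExtType K).
Implicit Types (d f : 'End(L)) (l x u : L).

(** In L viewed as a vector space over [F], the line through 1 is [F], and a linear projection onto
    that line serves as [f]. *)
Lemma subfield_projection (F : {subfield L}) : exists f : 'End(L),
  [/\ forall x u, x \in F -> f (x * u) = x * f u,
      forall u, f u \in F & f 1 = 1].
Proof.
pose P : 'End(fieldOver F) := projv 1%VS; pose g (u : L) : L := P u.
have gF x u : x \in F -> g (x * u) = x * g u.
  move=> Fx; have := linearZ_LR P (Subvs Fx) (u : fieldOver F).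
  by rewrite /g !fieldOver_scaleE.
have g_lin : linear g.
  move=> a u v; have := gF a%:A u (rpredZ a (mem1v F)).
  by rewrite -!scalerAl !mul1r => gZ; rewrite /g linearD /= -/(g v) -/(g _) gZ.
pose gL : {linear L -> L} := HB.pack g (GRing.isLinear.Build _ _ _ _ g g_lin).
exists (linfun gL); split=> [x u Fx|u|]; rewrite ?lfunE /=; first exact: gF.
  by rewrite -trivial_fieldOver; apply: memv_proj.
exact: (@projv_id _ (fieldOver F) 1%VS 1 (memv_line _)).
Qed.

(** For a projection [f] onto K, x = x f(1) = f(x) lies in K. *)
Lemma End_centraliser x :
  (forall f u, f (x * u) = x * f u) -> x \in 1%VS.
Proof.
move=> Cx; have [f [_ fK f1]] := subfield_projection 1%AS.
by rewrite -[x]mulr1 -[X in x * X]f1 -Cx; apply: fK.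
Qed.

(** L is purely inseparable over the separable closure of K, so some [l ^+ n], with n as in
    [iter_diff_comm_pchar], is separable. The n-th iterated commutator with [l] is the commutator
    with [l ^+ n], hence zero. *)
Lemma diff_op_commute_separable d :
  (forall x u, separable_element 1 x -> d (x * u) = x * d u) -> diff_op d.
Proof.
move=> Cd; apply: diff_op_nilpotent => l.
have [z [_ sep_z] insepL] := separable_inseparable_decomposition {:L} 1%AS.
have /purely_inseparable_elementP_pchar[n pchar_n zln] :=
  purely_inseparableP insepL l (memvf l).
exists n; rewrite iter_diff_comm_pchar //; apply/lfunP=> u.
rewrite diff_commE Cd ?subrr ?zero_lfunE //.
exact: (adjoin_separableP sep_z).
Qed.

(** The projection [f] onto the separable closure [<<1; z>>] is a differential operator; commuting
    with it forces x = f(x), which lies in that closure. *)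
Lemma diff_op_centraliser x :
  (forall d u, diff_op d -> d (x * u) = x * d u) -> separable_element 1 x.
Proof.
move=> Cx.
have [z [_ sep_z] /purely_inseparableP insepL] :=
  separable_inseparable_decomposition {:L} 1%AS.
have [f [fS Sf f1]] := subfield_projection <<1; z>>%AS.
apply: (adjoin_separableP sep_z); rewrite -[x]mulr1 -[X in x * X]f1 -Cx //.
apply: diff_op_commute_separable => y u sep_y; apply: fS.
rewrite -separable_inseparable_element insepL ?memvf // andbT.
by apply: separable_elementS sep_y; apply: sub1v.
Qed.

Lemma D_extensionE : D_extension L <-> purely_inseparable_extension L.
Proof.
split=> [DL | insepL].
  have [z [_ sep_z]] := separable_inseparable_decomposition {:L} 1%AS.
  suffices Kz: z \in 1%AS by rewrite (Fadjoin_idP Kz).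
  by apply: End_centraliser => f u; apply: diff_op_separable (DL f) sep_z.
move=> f; apply: diff_op_commute_separable => x u sep_x.
have Kx: x \in 1%AS.
  rewrite -separable_inseparable_element sep_x /=.
  by apply: (purely_inseparableP insepL); apply: memvf.
by have /vlineP[a ->] := Kx; rewrite -!scalerAl !mul1r linearZ.
Qed.

Lemma aspace_comp (A : {aspace 'End(L)}) f g :
  f \in A -> g \in A -> (f \o g)%VF \in A.
Proof. by move=> Af Ag; apply: (subvP (asubv A)); apply: memv_mul. Qed.

(** Density in contrapositive form. L is a simple module over [A], since [A] contains the
    multiplications; the induction on [s] corrects [v] by a K-multiple of the head [w]. *)
Lemma Jacobson_density (A : {aspace 'End(L)}) (s : seq L) v :
    (forall l, amull l \in A) ->
    (forall c, (forall a u, a \in A -> a (c * u) = c * a u) -> c \in 1%VS) ->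
    (forall a, a \in A -> {in s, forall u, a u = 0} -> a v = 0) ->
  v \in <<s>>%VS.
Proof.
move=> AL CA; elim: s v => [|w s IHs] v Av.
  by rewrite -[v]mul1r -amullE Av ?mem0v.
have [sw | s'w] := boolP (w \in <<s>>%VS).
  rewrite span_cons; apply: (subvP (addvSr _ _)).
  apply: IHs => a Aa as0; apply: Av => // u; rewrite inE => /predU1P[->|/as0//].
  have /coord_span-> : w \in <<in_tuple s>>%VS by [].
  rewrite linear_sum big1 // => i _; rewrite linearZ /= as0 ?scaler0 //.
  exact: mem_nth.
(* Otherwise [w] would lie in the span of [s] by induction; [e] is normalised by dividing by [a w],
   which multiplications in [A] permit. *)
have [e [Ae es0 ew1]] :
    exists e, [/\ e \in A, {in s, forall u, e u = 0} & e w = 1].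
  apply: NNPP => noe; case/negP: s'w; apply: IHs => a Aa as0.
  apply: NNPP => /eqP aw_neq0; apply: noe.
  exists (amull (a w)^-1%R \o a)%VF; split.
  - exact: aspace_comp.
  - by move=> u su; rewrite comp_lfunE (as0 u) // amullE mulr0.
  - by rewrite comp_lfunE amullE mulVf.
have av a : a \in A -> {in s, forall u, a u = 0} -> a v = a w * e v.
  move=> Aa as0; apply/eqP; rewrite -subr_eq0.
  have Ab : (a - (amull (a w) \o e)%VF) \in A by rewrite rpredB ?aspace_comp.
  have bE u : (a - (amull (a w) \o e)%VF) u = a u - a w * e u.
    by rewrite add_lfunE opp_lfunE comp_lfunE amullE.
  rewrite -bE Av // => u; rewrite inE bE.
  case/predU1P=> [->|su]; first by rewrite ew1 mulr1 subrr.
  by rewrite (as0 u) // es0 // mulr0 subrr.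
(* The composite of [e], multiplication by [u] and [a] kills [s] and sends [w] to [a u]; applying
   [av] to it shows that [e v] commutes with [a]. *)
have Kc: e v \in 1%VS.
  apply: CA => a u Aa.
  have Ab : (a \o (amull u \o e))%VF \in A by rewrite !aspace_comp.
  have := av _ Ab.
  rewrite !comp_lfunE !amullE ew1 mulr1 [e v * _]mulrC => -> //.
    by rewrite mulrC.
  by move=> y sy; rewrite !comp_lfunE es0 // amullE mulr0 linear0.
have /vlineP[k Dk] := Kc.
suffices svw: v - k *: w \in <<s>>%VS.
  by rewrite span_cons -[v](subrK (k *: w)) addrC memv_add // memvZ ?memv_line.
apply: IHs => a Aa as0; rewrite linearB linearZ /= av // Dk.
by rewrite -scalerAr mulr1 subrr.
Qed.

(** Density separates each basis vector from the others, so [A] contains the coordinate forms, and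
    any [f] is a combination of these with coefficients [f b_i] in L. *)
Lemma double_centraliser (A : {aspace 'End(L)}) f :
    (forall l, amull l \in A) ->
    (forall c, (forall a u, a \in A -> a (c * u) = c * a u) -> c \in 1%VS) ->
  f \in A.
Proof.
move=> AL CA; pose b := vbasis {:L}; have freeb : free b.
  exact: basis_free (vbasisP _).
have dual (i : 'I_(\dim {:L})) :
    exists e, [/\ e \in A, e b`_i = 1 & forall j : 'I__, j != i -> e b`_j = 0].
  pose s := [seq b`_(j : 'I__) | j <- enum 'I_(\dim {:L}) & j != i].
  apply: NNPP => noe.
  suffices: b`_i \in <<s>>%VS.
    move=> sbi; suffices: coord b i b`_i = 0.
      by move/eqP; rewrite coord_free // eqxx oner_eq0.
    have /coord_span-> : b`_i \in <<in_tuple s>>%VS by [].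
    rewrite linear_sum big1 // => j _; rewrite linearZ /=.
    have /mapP[k]: (in_tuple s)`_j \in s by apply: mem_nth.
    rewrite mem_filter => /andP[/negPf neq_ki _] ->.
    by rewrite coord_free // neq_ki mulr0.
  apply: Jacobson_density => // a Aa as0.
  apply: NNPP => /eqP ab_neq0; apply: noe.
  exists (amull (a b`_i)^-1%R \o a)%VF; split.
  - exact: aspace_comp.
  - by rewrite comp_lfunE amullE mulVf.
  - move=> j neq_ji; rewrite comp_lfunE (as0 b`_j) ?amullE ?mulr0 //.
    by apply: map_f; rewrite mem_filter neq_ji mem_enum.
have [e De] := fin_all_exists dual.
suffices ->: f = \sum_(i < \dim {:L}) (amull (f b`_i) \o e i)%VF.
  by rewrite rpred_sum // => i _; have [Ae _ _] := De i; apply: aspace_comp.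
apply/lfunP=> u; rewrite (coord_vbasis (memvf u)) !linear_sum /=.
apply: eq_bigr => j _; rewrite !linearZ /= sum_lfunE (bigD1 j) //=.
rewrite big1 => [|i neq_ij]; last first.
  rewrite comp_lfunE; have [_ _ ->] := De i; rewrite ?amullE ?mulr0 //.
  by rewrite eq_sym.
by rewrite comp_lfunE; have [_ -> _] := De j; rewrite amullE mulr1 addr0.
Qed.

End Centralisers.

(** * Conjugates, orbits of G(L/K) and normality *)

Section NormalExtensions.

Variables (K : fieldType) (L : fieldExtType K).
Implicit Types (f g : 'End(L)) (x z : L).

Lemma normal_extensionP :
  normal_extension L <->
  forall x, exists rs, minPoly 1 x = \prod_(z <- rs) ('X - z%:P).
Proof.
have eq_monic (p q : {poly L}) : p \is monic -> q \is monic -> p %= q -> p = q.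
  by move=> mon_p mon_q; rewrite eqp_monic // => /eqP.
have minP x : exists2 p : {poly K},
    irreducible_poly p & minPoly 1 x = map_poly (in_alg L) p.
  have /polyOver1P[p Dp] := minPolyOver 1 x; exists p => //; split.
    by rewrite -(size_map_poly (in_alg L)) -Dp size_minPoly ltnS.
  move=> q; rewrite -(size_map_poly (in_alg L)) -(dvdp_map (in_alg L)) -Dp.
  move=> q1 qp.
  have /orP[|] := minPoly_irr (alg_polyOver 1%AS q) qp.
    by rewrite Dp eqp_map.
  by rewrite -size_poly_eq1 (negPf q1).
split=> [nL x | nL p [_ irr_p] [x px0]].
  have [p irr_p Dp] := minP x.
  have [|rs Drs] := nL p irr_p; first by exists x; rewrite -Dp root_minPoly.
  exists rs; apply: eq_monic; rewrite ?monic_minPoly ?monic_prod_XsubC //.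
  by rewrite Dp.
have [q irr_q Dq] := minP x; have [rs Drs] := nL x; exists rs.
rewrite -Drs Dq eqp_sym eqp_map; apply: irr_p.
  by have [q_gt1 _] := irr_q; rewrite neq_ltn q_gt1 orbT.
by rewrite -(dvdp_map (in_alg L)) -Dq minPoly_dvdp ?alg_polyOver.
Qed.

(** By normality L is a splitting field, so the K-embedding of K(x) sending [x] to [z] extends to
    L. *)
Lemma normal_root_minPoly x z :
    normal_extension L -> root (minPoly 1 x) z ->
  exists2 g : 'End(L), galois_op g & g x = z.
Proof.
move=> /normal_extensionP nL xz0.
have [p Kp splitL] : splitting_field_axiom L.
  apply: normal_field_splitting => F y; have [rs Drs] := nL y.
  have := minPolyS y (sub1v F); rewrite Drs => /dvdp_prod_XsubC[m].
  rewrite eqp_monic ?monic_minPoly ?monic_prod_XsubC //.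
  by exists (mask m rs).
have hom1 := kHom1 (1%AS : {subfield L}) (1%AS : {subfield L}).
have rz: root (map_poly \1%VF (minPoly 1 x)) z.
  by rewrite (eq_map_poly (fun y => id_lfunE y)) map_poly_id.
have homz := kHomExtendP (subvv _) hom1 rz.
have splitL1 := splittingFieldForS (subv_adjoin 1%AS x) (subvf _) splitL.
have [g homg Dg] := kHom_extends (sub1v _) homz Kp splitL1.
exists g; first by rewrite /galois_op kAutfE.
by rewrite -Dg ?memv_adjoin // (kHomExtend_val hom1 rz).
Qed.

(** Every root of the minimal polynomial is a conjugate of [x], hence [x] itself; separability makes
    this root simple, so the polynomial is X - x. *)
Lemma normal_separable_fixed x :
    normal_extension L -> separable_element 1 x ->
  (forall g, galois_op g -> g x = x) -> x \in 1%VS.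
Proof.
move=> nL sep_x fix_x; have /normal_extensionP/(_ x)[rs Drs] := nL.
have rx z : (z \in rs) = (z == x).
  apply/idP/eqP=> [|->]; rewrite -root_prod_XsubC -Drs ?root_minPoly //.
  by case/(normal_root_minPoly nL)=> g /fix_x->.
have uniq_rs: uniq rs.
  by move: sep_x; rewrite /separable_element Drs separable_prod_XsubC.
apply/(@minPoly_XsubC _ L 1%AS x).
rewrite Drs (perm_big [:: x]) /= ?big_seq1 //.
by apply: uniq_perm => // z; rewrite rx inE.
Qed.

(** The orbit of [x] is finite because it consists of roots of the minimal polynomial, and each
    injective [g] permutes it. *)
Lemma galois_orbit x : exists rs : seq L,
  [/\ uniq rs, x \in rs & forall g, galois_op g -> perm_eq (map g rs) rs].
Proof.
pose orbit z := exists2 g : 'End(L), galois_op g & g x = z.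
have orbitM g z : galois_op g -> orbit z -> orbit (g z).
  rewrite /galois_op => hg [h hh <-]; exists (g \o h)%VF; last by rewrite comp_lfunE.
  by move: hg hh; rewrite /galois_op !kAutfE => hg hh; apply: comp_kHom.
have root_orbit z : orbit z -> root (minPoly 1 x) z.
  case=> g; rewrite /galois_op kAutfE => hg <-.
  exact: (kHom_root_id (sub1v _) hg (minPolyOver _ _) (memvf x) (root_minPoly _ _)).
(* Orbit elements are added to [rs] by classical choice; [k] bounds how many can follow, and [k = 0]
   would already give too many roots. *)
have maximal k rs : (size (minPoly 1 x) <= size rs + k)%N ->
    uniq rs -> {in rs, forall z, orbit z} -> x \in rs ->
  exists rs', [/\ uniq rs', x \in rs', {in rs', forall z, orbit z} &
    forall z, orbit z -> z \in rs'].
  elim: k rs => [|k IHk] rs le_rs Urs Ors rs_x.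
    have min0 : minPoly 1 x != 0 by rewrite monic_neq0 ?monic_minPoly.
    have rs0 : all (root (minPoly 1 x)) rs by apply/allP=> z /Ors/root_orbit.
    by have := max_poly_roots min0 rs0 Urs; rewrite ltnNge -[size rs]addn0 le_rs.
  have [|no] := classic (exists2 z, orbit z & z \notin rs).
    case=> z Oz rs'z; apply: (IHk (z :: rs)); rewrite /= ?addSnnS ?rs'z //.
      by move=> y; rewrite inE => /predU1P[->|/Ors].
    by rewrite inE rs_x orbT.
  exists rs; split=> // z Oz; apply: contraT => rs'z; case: no.
  by exists z.
have [] := maximal (size (minPoly 1 x)) [:: x]; rewrite ?leq_addl ?mem_head //.
  move=> z; rewrite inE => /eqP->; exists \1%VF; last by rewrite id_lfunE.
  by rewrite /galois_op kAutfE; apply: kHom1.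
move=> rs [Urs rs_x Ors rsO]; exists rs; split=> // g hg.
have Ug : uniq (map g rs).
  rewrite map_inj_uniq //; apply/lker0P/(@kAutf_lker0 _ _ 1%AS).
  by rewrite -kAutfE.
have sub_rs : {subset map g rs <= rs}.
  by move=> _ /mapP[z /Ors Oz ->]; apply/rsO/orbitM.
have [|_ eq_rs] := uniq_min_size Ug sub_rs; first by rewrite size_map.
exact: uniq_perm.
Qed.

(** [g] permutes the linear factors. The exponent [n] is 1 in [fixed_separable] and makes the roots
    separable in [fixed_normal]. *)
Lemma galois_orbit_poly x : exists rs : seq L,
  [/\ uniq rs, x \in rs &
   forall g n i (q := (\prod_(z <- rs) ('X - z%:P)) ^+ n), galois_op g ->
     g q`_i = q`_i].
Proof.
have [rs [Urs rs_x perm_rs]] := galois_orbit x; exists rs; split=> // g n i q hg.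
have gM : ahom_in {:L} g by rewrite -k1HomE -kAutfE.
pose gR : 'AEnd(L) := AHom gM.
have fix_prod : map_poly gR (\prod_(z <- rs) ('X - z%:P)) =
    \prod_(z <- rs) ('X - z%:P).
  by rewrite map_prod_XsubC -[in RHS](perm_big _ (perm_rs g hg)) big_map.
by rewrite -[g _]/(gR _) -coef_map rmorphXn /= fix_prod.
Qed.

(* The coefficients of the orbit polynomial of [x] are fixed by G(L/K); those of
   its [n]-th power, for a large power [n] of the characteristic, are moreover
   separable over K. *)
Lemma fixed_normal :
    (forall c, separable_element 1 c -> (forall g, galois_op g -> g c = c) ->
       c \in 1%VS) ->
  normal_extension L.
Proof.
move=> fixL; apply/normal_extensionP => x.
have [rs [_ rs_x fix_rs]] := galois_orbit_poly x.
have [y [_ sep_y] /purely_inseparableP insepL] :=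
  separable_inseparable_decomposition {:L} 1%AS.
(* A common exponent: the product of those of the elements of [rs]. *)
have [n pchar_n rs_n] : exists2 n, [pchar L].-nat n &
    {in rs, forall z, z ^+ n \in <<1; y>>%VS}.
  elim: (rs) => [|z s [n pchar_n sn]]; first by exists 1%N.
  have /purely_inseparable_elementP_pchar[m pchar_m zm] := insepL z (memvf z).
  exists (m * n)%N => [|t]; first by rewrite pnatM pchar_m.
  rewrite inE exprM => /predU1P[->|/sn st]; first exact: rpredX.
  by rewrite exprAC; apply: rpredX.
pose q : {poly L} := (\prod_(z <- rs) ('X - z%:P)) ^+ n.
have Sq : q \is a polyOver <<1; y>>%VS.
  (* By additivity of Frobenius, (X - z)^n = X^n - z^n. *)
  rewrite /q -prodrXl big_seq rpred_prod // => z /rs_n zn.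
  have pchar_n' : [pchar {poly L}].-nat n.
    by rewrite (eq_pnat _ (pchar_poly L)).
  rewrite exprDn_pchar // -polyCN -rmorphXn rpredD ?rpredX ?polyOverX //.
  by rewrite polyOverC exprNn_pchar ?rpredN.
have Kq : q \is a polyOver 1%AS.
  apply/polyOverP=> i; apply: fixL => [|g]; last exact: fix_rs.
  exact: (adjoin_separableP sep_y) (polyOverP Sq i).
have qx0 : root q x.
  rewrite /q; case: (n) pchar_n => [|m _]; first by [].
  by rewrite /root horner_exp expf_eq0 -/(root _ _) root_prod_XsubC.
have [rs' Dq] : exists rs', q = \prod_(z <- rs') ('X - z%:P).
  rewrite /q; elim: (n) => [|m [s Ds]]; first by exists [::]; rewrite big_nil.
  by exists (rs ++ s); rewrite exprS Ds big_cat.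
have := minPoly_dvdp Kq qx0; rewrite Dq => /dvdp_prod_XsubC[m].
rewrite eqp_monic ?monic_minPoly ?monic_prod_XsubC // => /eqP.
by exists (mask m rs').
Qed.

(** The orbit polynomial of [x] has coefficients in K and distinct roots, and the minimal polynomial
    divides it. *)
Lemma fixed_separable :
  (forall c, (forall g, galois_op g -> g c = c) -> c \in 1%VS) ->
  separable 1%VS {:L}.
Proof.
move=> fixL; apply/(@separableP _ _ 1%AS {:L}%AS) => x _.
have [rs [Urs rs_x fix_rs]] := galois_orbit_poly x.
rewrite /separable_element; set q := \prod_(z <- rs) ('X - z%:P).
suffices /dvdp_separable: minPoly 1 x %| q by apply; rewrite separable_prod_XsubC.
apply: (@minPoly_dvdp _ _ 1%AS); last by rewrite root_prod_XsubC.
by apply/polyOverP=> i; apply: fixL => g /(fix_rs _ 1%N i).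
Qed.

End NormalExtensions.

(** * Generated subalgebras and their centralisers *)

Section GeneratedSubalgebra.

Variables (K : fieldType) (L : fieldExtType K) (S T : 'End(L) -> Prop).

(** The centraliser of [amull c] is a subalgebra containing the generators, hence all of E(L/K),
    whose centre is K. *)
Lemma generated_End_centraliser c :
    (forall f, generated_subalgebra S T f) ->
    (forall f u, S f -> f (c * u) = c * f u) ->
    (forall f u, T f -> f (c * u) = c * f u) ->
  c \in 1%VS.
Proof.
move=> genL CS CT.
have CcP (f : 'End(L)) :
    f \in 'C[amull c]%AS <-> forall u, f (c * u) = c * f u.
  split=> [/cent1vP/lfunP Cf u | Cf].
    by have := Cf u; rewrite !lfun_mulE !amullE.
  by apply/cent1vP/lfunP=> u; rewrite !lfun_mulE !amullE.
apply: End_centraliser => f; apply/CcP.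
by apply: genL => g; [move/CS | move/CT] => Cg; apply/CcP.
Qed.

Lemma centraliser_generated_End f :
    (forall l, S (amull l)) ->
    (forall c, (forall f u, S f -> f (c * u) = c * f u) ->
       (forall f u, T f -> f (c * u) = c * f u) -> c \in 1%VS) ->
  generated_subalgebra S T f.
Proof.
move=> SL CST A SA TA; apply: double_centraliser => [l | c Cc].
  exact/SA/SL.
by apply: CST => g u; [move/SA | move/TA] => /Cc.
Qed.

End GeneratedSubalgebra.

(** * Characterisation of B- and G-extensions, and the conclusion *)

Section Extensions.

Variables (K : fieldType) (L : fieldExtType K).

Lemma galois_opM (g : 'End(L)) : galois_op g -> {morph g : x y / x * y}.
Proof. by rewrite /galois_op kAutfE => /kHom_monoid_morphism[]. Qed.

Lemma galois_op_commute (c : L) (g : 'End(L)) : galois_op g ->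
  (forall u, g (c * u) = c * g u) <-> g c = c.
Proof.
move=> hg; have g1 : g 1 = 1.
  by move: hg; rewrite /galois_op kAutfE => /kHom_monoid_morphism[].
split=> [Cc | gc u]; first by rewrite -{1}[c]mulr1 Cc g1 mulr1.
by rewrite galois_opM // gc.
Qed.

Lemma B_extensionE : B_extension L <-> normal_extension L.
Proof.
split=> [BL | nL f].
  apply: fixed_normal => c sep_c fix_c.
  apply: generated_End_centraliser BL _ _ => f u.
    by move/diff_op_separable; apply.
  by move=> hf; move: u; apply/(galois_op_commute c hf); apply: fix_c.
apply: centraliser_generated_End => [l | c CD CG]; first by exists 0%N, l.
apply: normal_separable_fixed => // [|g hg].
  by apply: diff_op_centraliser => d u /CD.
by apply/(galois_op_commute c hg) => u; apply: CG.
Qed.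

Lemma G_extension_B : G_extension L -> B_extension L.
Proof.
move=> GL f A DA GA; apply: GL => // _ [l ->].
by apply: DA; exists 0%N, l.
Qed.

Lemma G_extensionE : G_extension L <-> galois_extension L.
Proof.
split=> [GL | [nL /(@separableP _ _ 1%AS {:L}%AS) sepL] f].
  (* Normality is inherited from the B-extension case, as L consists of the operators of order 0. *)
  split; first exact/B_extensionE/G_extension_B.
  apply: fixed_separable => c fix_c.
  apply: generated_End_centraliser GL _ _ => f u.
    by move=> [l ->]; rewrite !amullE mulrCA.
  by move=> hf; move: u; apply/(galois_op_commute c hf); apply: fix_c.
apply: centraliser_generated_End => [l | c _ CG]; first by exists l.
apply: normal_separable_fixed => // [|g hg]; first exact/sepL/memvf.
by apply/(galois_op_commute c hg) => u; apply: CG.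
Qed.

End Extensions.

Theorem corollary6p7 (K : fieldType) (L : fieldExtType K) :
  (B_extension L /\ ~ G_extension L /\ ~ D_extension L) <->
  (normal_extension L /\ ~ galois_extension L /\
   ~ purely_inseparable_extension L).
Proof.
by rewrite B_extensionE G_extensionE D_extensionE.
Qed.
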